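(* Let $k$ be a fixed constant and let $m=m(n)\le An$, where $A<1$ is a constant. Then $$\limsup_{n\to\infty}\mathbf{P}[P_{n,m}\text{ has girth at most } k]<1.$$
   Context: $\mathcal{P}(n,m)$ is the set of simple labelled planar graphs on vertex set $\{1,\ldots,n\}$ with exactly $m$ edges; $P_{n,m}$ is chosen uniformly at random from $\mathcal{P}(n,m)$. The girth of a graph is the length of its shortest cycle (infinite for acyclic graphs). *)

(* Defs.v *)
From HB Require Import structures.
From mathcomp Require Export all_boot all_order all_algebra.
From mathcomp Require Export all_classical all_reals all_analysis.
Export numFieldNormedType.Exports.

Set Implicit Arguments.
Unset Strict Implicit.
Unset Printing Implicit Defensive.

Import Order.TTheory GRing.Theory Num.Theory.

Local Open Scope classical_set_scope.
Local Open Scope ring_scope.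

(* A simple graph on the vertex type T is given by its edge set, a set of
   two-element subsets of T. *)
Definition simple_graph (T : finType) (E : {set {set T}}) : bool :=
  [forall e in E, #|e| == 2%N].

Definition adj (T : finType) (E : {set {set T}}) : rel T :=
  fun u v => [set u; v]%SET \in E.

(* The vertices of a cycle in cyclic order; its length is size c. *)
Definition graph_cycle (T : finType) (E : {set {set T}}) (c : seq T) : bool :=
  [&& (2 < size c)%N, uniq c & cycle (adj E) c].

(* Equal to +oo when the graph is acyclic, as the infimum of set0. *)
Definition girth (R : realType) (T : finType) (E : {set {set T}}) : \bar R :=
  ereal_inf [set ((size c)%:R)%:E | c in [set c : seq T | graph_cycle E c]].

(* A drawing in the plane R * R without crossings: pos places the vertices and
   the restriction of arc e to [0, 1] parametrizes the simple arc that
   represents the edge e. *)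
Record plane_drawing (R : realType) (T : finType) (E : {set {set T}})
    (pos : T -> R * R) (arc : {set T} -> R -> R * R) : Prop := {
  pos_inj : injective pos ;
  arc_continuous : forall e, e \in E -> {within `[0, 1], continuous (arc e)} ;
  arc_inj : forall e, e \in E -> {in `[0, 1] &, injective (arc e)} ;
  arc_ends : forall e, e \in E ->
    [set arc e 0; arc e 1] = [set pos v | v in [set v | v \in e]] ;
  arc_avoids_vertices : forall e, e \in E ->
    forall (t : R) (v : T), t \in `]0, 1[ -> arc e t != pos v ;
  arc_disjoint : forall e f, e \in E -> f \in E -> e != f ->
    forall s t : R, s \in `]0, 1[ -> t \in `]0, 1[ -> arc e s != arc f t }.

Definition planar (R : realType) (T : finType) (E : {set {set T}}) : Prop :=
  exists pos arc, @plane_drawing R T E pos arc.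

(* The vertex labels are 0, ..., n-1. *)
Definition planar_graphs (R : realType) (n m : nat) : {set {set {set 'I_n}}} :=
  [set E : {set {set 'I_n}} |
    [&& simple_graph E, #|E| == m & `[< planar R E >]]]%SET.

(* Probability of ev for a uniformly random element of S; 0 if S is empty. *)
Definition uniform_pr (R : realType) (X : finType) (S : {set X})
    (ev : pred X) : R :=
  #|[set x in S | ev x]%SET|%:R / #|S|%:R.

(* Main.v *)
(* Switching.  Let E have a cycle c of length l <= k.  Delete the l edges of c;
   the remaining graph has at least n - m >= (1 - A) n tree components, so there
   are of order n^(2l) ways to reinsert l edges, disjoint from one another, each
   joining two of these components.  The new graph is planar, since a forest can
   be drawn away from the rest, and all its cycles are cycles of E, c excluded.
   Conversely the new graph together with the positions of c (n^l choices) and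
   of the new edges among its m edges determines E.  Hence, for a constant C,
   the mean number of short cycles is at most C, and the graphs with exactly
   j + 1 short cycles are at most C times as many as those with at most j.  By
   Markov's inequality at least half of the graphs have at most 2C short cycles,
   so a positive fraction has none. *)

Require Import Defs.
From mathcomp Require Import zify ring lra.
Set Implicit Arguments.
Unset Strict Implicit.
Unset Printing Implicit Defensive.
Import Order.TTheory GRing.Theory Num.Theory.

(** * Sparse vertex sets, tree components and forests *)

Section Forests.
Import mathcomp.boot.fintype mathcomp.boot.finset.

Definition induced (T : finType) (E : {set {set T}}) (S : {set T}) :
  {set {set T}} := [set e in E | e \subset S].

Definition deg_in (T : finType) (E : {set {set T}}) (S : {set T}) (v : T) : nat :=
  #|[set e in induced E S | v \in e]|.

Lemma card_edge (T : finType) (E : {set {set T}}) (e : {set T}) :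
  simple_graph E -> e \in E -> #|e| = 2.
Proof. by move=> /'forall_implyP/(_ e) h /h /eqP. Qed.

Lemma simple_graphS (T : finType) (E F : {set {set T}}) :
  F \subset E -> simple_graph E -> simple_graph F.
Proof.
move=> /subsetP sFE sE; apply/'forall_implyP => e /sFE eE.
by rewrite (card_edge sE eE).
Qed.

(** Double counting of incidences: every edge has two ends. *)
Lemma leq_card_induced (T : finType) (E : {set {set T}}) (S : {set T}) :
  simple_graph E -> (forall v, v \in S -> 1 < deg_in E S v) ->
  #|S| <= #|induced E S|.
Proof.
move=> sE hd; suff: #|S| * 2 <= #|induced E S| * 2 by rewrite leq_pmul2r.
rewrite -!sum_nat_const.
apply: (@leq_trans (\sum_(v in S) deg_in E S v)); first exact: leq_sum.
rewrite /deg_in; under eq_bigr do rewrite -sum1dep_card.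
rewrite (exchange_big_dep (mem (induced E S))) /=; last by move=> v e _ /andP[].
apply: leq_sum => e eE.
have /[!inE]/andP[e1 e2] := eE.
rewrite sum1dep_card -(card_edge sE e1) subset_leq_card //.
by apply/subsetP => v; rewrite !inE => /and3P[].
Qed.

Lemma card_inducedD1 (T : finType) (E : {set {set T}}) (S : {set T}) (v : T) :
  #|induced E S| = #|induced E (S :\ v)| + deg_in E S v.
Proof.
rewrite -(cardsID [set e : {set T} | v \in e] (induced E S)) addnC; congr (_ + _).
  apply: eq_card => e; rewrite !inE subsetD1.
  by case: (e \in E); rewrite /= ?andbF // andbC.
by rewrite /deg_in; apply: eq_card => e; rewrite !inE.
Qed.

Lemma deg_inS (T : finType) (E : {set {set T}}) (S S' : {set T}) (v : T) :
  S \subset S' -> deg_in E S v <= deg_in E S' v.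
Proof.
move=> sS; apply: subset_leq_card; apply/subsetP => e; rewrite !inE.
by move=> /andP[/andP[-> eS] ->]; rewrite (subset_trans eS sS).
Qed.

(** It yields the vertex to peel off in the inductions on vertex sets. *)
Lemma deg_in_small (T : finType) (E : {set {set T}}) (S : {set T}) :
  simple_graph E -> #|induced E S| < #|S| ->
  exists2 v, v \in S & deg_in E S v <= 1.
Proof.
move=> sE hlt.
have : ~~ [forall v in S, 1 < deg_in E S v].
  apply: contraL hlt; rewrite -leqNgt => /'forall_implyP h.
  exact: leq_card_induced.
by rewrite negb_forall_in => /'exists_andP[v]; rewrite -leqNgt => -[]; exists v.
Qed.

Lemma edge_other_end (T : finType) (E : {set {set T}}) (e : {set T}) (v : T) :
  simple_graph E -> e \in E -> v \in e -> exists2 u, v != u & e = [set v; u].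
Proof.
move=> sE eE ve; have /eqP/cards2P[a [b [ab eab]]] := card_edge sE eE.
move: ve; rewrite eab !inE => /orP[]/eqP->; first by exists b.
by exists a; rewrite 1?eq_sym // setUC.
Qed.

Lemma disjoint_setU1 (T : finType) (A B : {set T}) (v : T) :
  [disjoint A & v |: B] = (v \notin A) && [disjoint A & B].
Proof.
by rewrite disjoint_sym -setI_eq0 setIUl setU_eq0 !setI_eq0 disjoints1 disjoint_sym.
Qed.

(* Take [U] to be the union of the tree components and [R] a system of
   representatives of them: components with a cycle have at least as many
   edges as vertices, so [#|R|] is at least the number of vertices minus the
   number of edges.  The last clause says both that [E] is a forest on [U] and
   that no component of this forest contains two elements of [R]. *)
Lemma tree_representatives (T : finType) (E : {set {set T}}) (W : {set T}) :
  simple_graph E -> exists U R : {set T},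
  [/\ R \subset U, U \subset W,
      {in induced E W, forall e : {set T}, (e \subset U) || [disjoint e & U]},
      #|W| <= #|R| + #|induced E W| &
      forall S : {set T}, S \subset U -> S != set0 ->
        #|induced E S| + maxn 1 #|S :&: R| <= #|S|].
Proof.
move=> sE; have [N] := ubnP #|W|; elim: N W => // N IHN W ltWN.
(* With at least as many edges as vertices, an empty [R] suffices. *)
have [hW|hW] := leqP #|W| #|induced E W|.
  exists set0, set0; split; rewrite ?sub0set //.
  - by move=> e _; rewrite disjoints_subset setC0 subsetT orbT.
  - by rewrite cards0.
  - by move=> S; rewrite subset0 => ->.
have [v vW dv] := deg_in_small sE hW.
have [|U [R [sRU sUW cl cW sp]]] := IHN (W :\ v).
  by move: ltWN; rewrite (cardsD1 v W) vW; lia.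
have cWv : #|W| = #|W :\ v|.+1 by rewrite (cardsD1 v W) vW.
have cEv := card_inducedD1 E W v.
have vU : v \notin U by apply/negP => /(subsetP sUW); rewrite !inE eqxx.
have vR : v \notin R by apply: contra vU; apply: (subsetP sRU).
have sUW' : U \subset W := subset_trans sUW (subsetDl _ _).
have clv e : e \in induced E W -> v \notin e -> (e \subset U) || [disjoint e & U].
  by rewrite inE => /andP[eE eW] ve; apply: cl; rewrite inE eE subsetD1 eW.
(* A vertex may join [U] if it brings at most one unit in all, as an edge or as a representative. *)
have grow (R' : {set T}) : R' :\ v = R -> deg_in E W v + (v \in R') <= 1 ->
    forall S : {set T}, S \subset v |: U -> S != set0 ->
    #|induced E S| + maxn 1 #|S :&: R'| <= #|S|.
  move=> eR' hR' S sS S0.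
  have sSU : S :\ v \subset U by rewrite subDset.
  have cS : #|S :&: R'| = #|(S :\ v) :&: R| + ((v \in S) && (v \in R')).
    rewrite (cardsD1 v (S :&: R')) inE addnC; congr (_ + _).
    by apply: eq_card => z; rewrite -eR' !inE; case: (z == v).
  have [vS|vS] := boolP (v \in S); last first.
    have eS : S :\ v = S.
      by apply/setDidPl; rewrite disjoint_sym disjoints1.
    by have := sp S; rewrite cS eS (negbTE vS) addn0 -{1}eS; apply.
  have sSW : S \subset W.
    by apply: (subset_trans sS); rewrite subUset sub1set vW.
  have := deg_inS E v sSW; have := card_inducedD1 E S v.
  rewrite cS vS /= (cardsD1 v S) vS.
  have [Sv0|Sv0] := eqVneq (S :\ v) set0.
    have -> : induced E S = set0.
      apply/setP => e; rewrite !inE; apply/negP => /andP[eE eS].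
      have := subset_leq_card eS.
      by rewrite (card_edge sE eE) (cardsD1 v S) vS Sv0 cards0.
    by rewrite Sv0 set0I !cards0 => _ _; case: (v \in R').
  move=> h1 h2; move: (sp _ sSU Sv0) h1 h2 hR'.
  move: #|induced E S| #|induced E (S :\ v)| #|S :\ v| #|_ :&: R| => a b c r.
  move: (deg_in E S v) (deg_in E W v) (nat_of_bool (v \in R')) => d d' x.
  by clear; rewrite !maxnE; lia.
(* An isolated vertex is a new tree and represents it. *)
have [d0|d1] := posnP (deg_in E W v).
  exists (v |: U), (v |: R); split.
  - exact: setUS.
  - by rewrite subUset sub1set vW.
  - move=> e eW; have ve : v \notin e.
      apply/negP => ve; have : e \in [set e in induced E W | v \in e].
        by rewrite inE eW.
      by move/eqP: d0; rewrite cards_eq0 => /eqP ->; rewrite inE.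
    have /orP[eU|eU] := clv e eW ve.
      by rewrite (subset_trans eU) ?subsetU1.
    by rewrite disjoint_setU1 ve eU orbT.
  - by rewrite cWv cEv d0 addn0 cardsU1 vR.
  - by apply: grow; rewrite ?setU1K // d0; case: (_ \in _).
have {dv}d1 : deg_in E W v = 1 by apply/eqP; rewrite eqn_leq dv.
have /eqP/cards1P[e0 he0] := d1.
have : e0 \in [set e in induced E W | v \in e] by rewrite he0 set11.
rewrite !inE => /andP[/andP[e0E e0W] ve0].
have only e : e \in induced E W -> v \in e -> e = e0.
  by move=> eW ve; apply/set1P; rewrite -he0 inE eW.
have [u vu ee0] := edge_other_end sE e0E ve0.
(* A leaf hanging on [U] enlarges a tree. Otherwise it hangs on a discarded component and is
   discarded too, its edge paying for it in the count. *)
have [uU|uU] := boolP (u \in U).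
  exists (v |: U), R; split.
  - exact: (subset_trans sRU (subsetU1 _ _)).
  - by rewrite subUset sub1set vW.
  - move=> e eW; have [ve|ve] := boolP (v \in e).
      by rewrite (only e eW ve) ee0 subUset !sub1set setU11 setU1r.
    have /orP[eU|eU] := clv e eW ve.
      by rewrite (subset_trans eU) ?subsetU1.
    by rewrite disjoint_setU1 ve eU orbT.
  - by rewrite cWv cEv d1 addn1 addnS.
  - apply: grow; last by rewrite d1 (negbTE vR).
    by apply/setDidPl; rewrite disjoint_sym disjoints1.
exists U, R; split=> //; last by rewrite cWv cEv d1 addn1 addnS.
move=> e eW; have [ve|ve] := boolP (v \in e); last exact: clv.
rewrite (only e eW ve) ee0; apply/orP; right.
by rewrite disjoint_sym disjoint_setU1 vU disjoint_sym disjoints1.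
Qed.

(** Each edge of [M] inside [S] uses up two elements of [S :&: R], and half of [r] is less than
    [maxn 1 r]. The conclusion expresses that the union is a forest on [U]. *)
Lemma matching_sparse (T : finType) (E M : {set {set T}}) (U R : {set T}) :
  (forall S : {set T}, S \subset U -> S != set0 ->
     #|induced E S| + maxn 1 #|S :&: R| <= #|S|) ->
  simple_graph M -> trivIset M -> cover M \subset R ->
  forall S : {set T}, S \subset U -> S != set0 -> #|induced (E :|: M) S| < #|S|.
Proof.
move=> sp sM tM cM S sS S0.
have h2 : #|induced M S| * 2 <= #|S :&: R|.
  have tMS : trivIset (induced M S).
    by apply: trivIsetS tM; apply/subsetP => e /[!inE]/andP[].
  apply: (@leq_trans #|cover (induced M S)|).
    rewrite -(eqP tMS) -sum_nat_const; apply: leq_sum => e /[!inE]/andP[eM _].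
    by rewrite (card_edge sM eM).
  apply: subset_leq_card; apply/bigcupsP => e /[!inE]/andP[eM eS].
  rewrite subsetI eS (subset_trans _ cM) //; exact: (bigcup_sup e).
have h1 : #|induced (E :|: M) S| <= #|induced E S| + #|induced M S|.
  apply: leq_trans (leq_card_setU _ _); apply: subset_leq_card.
  by apply/subsetP => e; rewrite !inE andb_orl.
by have := sp S sS S0; lia.
Qed.

(** * Cycles and their edge sets *)

Definition cycle_edges (T : finType) (c : seq T) : {set {set T}} :=
  [set [set v; next c v] | v in c].

Lemma next_next_neq (T : finType) (c : seq T) (v : T) :
  uniq c -> 2 < size c -> v \in c -> next c (next c v) != v.
Proof.
move=> uc sc /rot_to[i s es].
rewrite -!(next_rot i uc) es; move: uc sc; rewrite -(rot_uniq i) -(size_rot i c) es.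
case: s {es} => [//|a [//|b s]] /=; rewrite !inE !negb_or.
case/andP=> /and3P[va vb _] _ _.
by rewrite eqxx [a == v]eq_sym (negbTE va) eqxx eq_sym.
Qed.

(** Distinct vertices with the same edge would be each other's successors, which is impossible on a
    cycle of length at least three. *)
Lemma card_cycle_edges (T : finType) (c : seq T) :
  uniq c -> 2 < size c -> #|cycle_edges c| = size c.
Proof.
move=> uc sc; rewrite -(card_uniqP uc) card_in_imset // => v w vc wc evw.
apply/eqP/negPn/negP => vw.
have : v \in [set w; next c w] by rewrite -evw set21.
have : w \in [set v; next c v] by rewrite evw set21.
rewrite !inE (negbTE vw) eq_sym (negbTE vw) /= => /eqP wv /eqP vw'.
by have := next_next_neq uc sc vc; rewrite -wv -vw' eqxx.
Qed.

Lemma graph_cycleP (T : finType) (E : {set {set T}}) (c : seq T) :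
  reflect [/\ 2 < size c, uniq c & cycle_edges c \subset E] (graph_cycle E c).
Proof.
apply: (iffP and3P) => -[sc uc hc]; split=> //.
  by apply/subsetP => _ /imsetP[v vc ->]; exact: (next_cycle hc).
apply: cycle_from_next => // v vc.
by apply: (subsetP hc); apply/imsetP; exists v.
Qed.

(** A cycle has as many edges as vertices, so it violates the strict sparsity of a forest. *)
Lemma graph_cycle_induced (T : finType) (E : {set {set T}}) (c : seq T) :
  graph_cycle E c -> #|[set v in c]| <= #|induced E [set v in c]|.
Proof.
move=> /graph_cycleP[sc uc hc].
have -> : #|[set v in c]| = #|cycle_edges c|.
  by rewrite cardsE (card_uniqP uc) card_cycle_edges.
apply: subset_leq_card; apply/subsetP => e ec.
rewrite inE (subsetP hc) //=; move/imsetP: ec => [v vc ->].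
by apply/subsetP => w /[!inE]/orP[]/eqP->; rewrite ?mem_next.
Qed.

(** No edge crosses the border of [U], so membership in [U] is constant along the cycle. *)
Lemma graph_cycle_closed (T : finType) (E : {set {set T}}) (U : {set T}) (c : seq T) :
  {in E, forall e : {set T}, (e \subset U) || [disjoint e & U]} -> graph_cycle E c ->
  [set v in c] \subset U \/ [disjoint [set v in c] & U].
Proof.
move=> cl /and3P[]; case: c => // x p _ uc hc.
have step v : v \in x :: p -> (next (x :: p) v \in U) = (v \in U).
  move=> vc; have /cl/orP[] := next_cycle hc vc.
    by rewrite subUset !sub1set => /andP[-> ->].
  by rewrite disjoints_subset subUset !sub1set !inE => /andP[/negbTE-> /negbTE->].
have all_eq v : v \in x :: p -> (v \in U) = (x \in U).
  move=> vc; have cc : fcycle (next (x :: p)) (x :: p) by exact: cycle_next.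
  have /iter_findex <- : fconnect (next (x :: p)) x v.
    by rewrite (fconnect_cycle cc) ?mem_head.
  elim: (findex _ _ _) => // j IH; rewrite iterS step //.
  by elim: j {IH} => [|j IH]; rewrite ?mem_head // iterS mem_next.
have [xU|xU] := boolP (x \in U); [left|right].
  by apply/subsetP => v /[!inE] vc; rewrite all_eq.
rewrite disjoints_subset; apply/subsetP => v /[!inE] vc.
by rewrite all_eq.
Qed.

Lemma edge_end (T : finType) (E : {set {set T}}) (e : {set T}) :
  simple_graph E -> e \in E -> exists v, v \in e.
Proof.
move=> sE eE; have /eqP/cards2P[a [b [_ ->]]] := card_edge sE eE.
by exists a; rewrite set21.
Qed.

(** A cycle inside [U] contradicts sparsity, and one outside [U] contains no edge of [M]. *)
Lemma cycle_avoids_forest (T : finType) (E M : {set {set T}}) (U : {set T})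
    (c : seq T) :
  simple_graph M -> {in M, forall e : {set T}, e \subset U} ->
  {in E, forall e : {set T}, (e \subset U) || [disjoint e & U]} ->
  (forall S : {set T}, S \subset U -> S != set0 -> #|induced (E :|: M) S| < #|S|) ->
  graph_cycle (E :|: M) c -> graph_cycle E c.
Proof.
move=> sM MU cl sp hc; have [sc uc hcE] := graph_cycleP _ _ hc.
have [|cU|cU] := @graph_cycle_closed _ (E :|: M) U c _ hc.
- by move=> e /[!inE]/orP[/cl//|/MU->].
- have := sp _ cU; rewrite ltnNge graph_cycle_induced //= => /(_ _)/negP; case => //.
  by apply/set0Pn; case: c {hc uc hcE cU} sc => // x p _; exists x; rewrite !inE eqxx.
apply/graph_cycleP; split=> //; apply/subsetP => e ec.
have := subsetP hcE e ec; rewrite inE => /orP[//|eM].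
have [v ve] := edge_end sM eM.
move/imsetP: ec => [w wc ew]; have := subsetP (MU e eM) w.
rewrite ew set21 => /(_ isT) wU.
by have := disjointFr cU (x := w); rewrite inE wc wU => /(_ isT).
Qed.

End Forests.

(** * Plane drawings *)

Section Drawing.
Import mathcomp.boot.fintype mathcomp.boot.finset.
Local Open Scope ring_scope.

(** Finitely many points leave a gap after [a], in which a leaf can be placed. *)
Lemma right_gap (R : realType) (s : seq R) (a : R) :
  exists2 y, a < y & {in s, forall z, z <= a \/ y < z}.
Proof.
elim: s => [|z s [y ay hy]]; first by exists (a + 1); rewrite ?ltrDl.
have [za|az] := lerP z a.
  exists y => // w; rewrite inE => /predU1P[->|/hy//]; by left.
exists (Num.min y ((a + z) / 2)).
  by rewrite lt_min ay /=; lra.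
move=> w; rewrite inE => /predU1P[->|/hy[|]]; [right|by left|right].
  by rewrite gt_min; apply/orP; right; lra.
by rewrite gt_min; apply/orP; left.
Qed.

(* A leaf is placed immediately to the right of its neighbour. *)
Lemma book_embedding (R : realType) (T : finType) (E : {set {set T}})
    (U : {set T}) (M : R) :
  simple_graph E ->
  (forall S : {set T}, S \subset U -> S != set0 -> (#|induced E S| < #|S|)%N) ->
  exists x : T -> R,
  [/\ {in U &, injective x}, {in U, forall v, M < x v} &
      {in U & &, forall a b c, {in U, forall d, [set a; b] \in E ->
        [set c; d] \in E -> x a < x c -> x c < x b -> x b < x d -> False}}].
Proof.
move=> sE; have [N] := ubnP #|U|; elim: N U => // N IHN U ltUN sp.
have [U0|U0] := eqVneq U set0.
  by exists (fun=> M); rewrite U0; split=> [v w|v|v w z]; rewrite !inE.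
have [v vU dv] := deg_in_small sE (sp U (subxx _) U0).
have sU'U : U :\ v \subset U := subsetDl _ _.
have [||x [xinj xM xnc]] := IHN (U :\ v).
- by move: ltUN; rewrite (cardsD1 v U) vU.
- by move=> S sS; apply: sp; exact: subset_trans sS sU'U.
have vnot w : [set v; w] \in E -> w != v.
  move=> /(card_edge sE); rewrite cards2; by case: eqVneq => // ->.
(* [a0] is the position of the neighbour of [v], or the bound [M] if [v] has none in [U]. *)
have [a0 [M_a0 nb]] : exists a0, M <= a0 /\
    {in U, forall w, [set v; w] \in E -> x w = a0}.
  have [[u uU vuE]|none] :=
      pselect (exists2 u, u \in U & [set v; u] \in E); last first.
    by exists M; split=> // w wU vwE; case: none; exists w.
  exists (x u); split.
    by apply/ltW/xM; rewrite !inE vnot.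
  move=> w wU vwE; congr x; apply/eqP/negPn/negP => wu.
  move: dv; rewrite leqNgt => /negP; apply.
  have sub : [set [set v; u]; [set v; w]] \subset [set e in induced E U | v \in e].
    by rewrite subUset !sub1set !inE eqxx vuE vwE !subUset !sub1set vU uU wU.
  apply: leq_trans (subset_leq_card sub); rewrite cards2; case: eqVneq => //.
  move=> /setP/(_ w); rewrite !inE (negbTE wu) (negbTE (vnot w vwE)) eqxx orbT.
  by [].
have [y a0y gap] := right_gap [seq x w | w in U :\ v] a0.
have {}gap w : w \in U -> w != v -> x w <= a0 \/ y < x w.
  by move=> wU wv; apply: gap; apply: image_f; rewrite !inE wv.
exists (fun w => if w == v then y else x w); split.
- move=> a b aU bU; case: eqVneq => [->|av]; case: eqVneq => [->//|bv] e.
  + by case: (gap b bU bv) => h; exfalso; lra.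
  + by case: (gap a aU av) => h; exfalso; lra.
  + by apply: xinj; rewrite // !inE ?av ?bv.
- move=> w wU; case: eqVneq => [_|wv]; first exact: le_lt_trans M_a0 a0y.
  by apply: xM; rewrite !inE wv.
move=> a b c aU bU cU d dU abE cdE.
(* The vertex [v] lies to the right of its neighbour with no vertex in between, so its edge crosses
   no other. *)
case: (eqVneq a v) => [av|av].
  move: abE; rewrite av => abE; rewrite (negbTE (vnot _ abE)) (nb b) //.
  by case: ifP => _; lra.
case: (eqVneq b v) => [bv|bv].
  move: abE; rewrite setUC bv => abE; rewrite (nb a) //.
  by case: eqVneq => [_|cv]; [lra | case: (gap c cU cv); lra].
case: (eqVneq c v) => [cv|cv].
  by move: cdE; rewrite cv => cdE; rewrite (negbTE (vnot _ cdE)) (nb d) //; lra.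
case: (eqVneq d v) => [dv'|dv'].
  move: cdE; rewrite setUC dv' => cdE; rewrite (nb c) //.
  by case: (gap b bU bv) => h; lra.
by apply: xnc; rewrite // !inE ?av ?bv ?cv ?dv'.
Qed.

(** The height is the product of the distances to the two ends. Enlarging the interval raises the
    arch, so arches over nested intervals do not cross. *)
Definition parabola (R : realType) (lo hi t : R) : R * R :=
  let x := lo + t * (hi - lo) in (x, (x - lo) * (hi - x)).

Lemma parabola_continuous (R : realType) (lo hi : R) : continuous (parabola lo hi).
Proof.
move=> t; have hx : {for t, continuous (fun s : R => lo + s * (hi - lo))}.
  by apply: cvgD; [exact: cvg_cst | apply: cvgM; [exact: cvg_id|exact: cvg_cst]].
have hy : {for t, continuous (fun s : R =>
    (lo + s * (hi - lo) - lo) * (hi - (lo + s * (hi - lo))))}.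
  by apply: cvgM; apply: cvgB => //; exact: cvg_cst.
exact: cvg_pair hx hy.
Qed.

(** The arcs are compact and finite in number. The bound leaves a half-plane free for the forest. *)
Lemma drawing_bounded (R : realType) (T : finType) (E : {set {set T}})
    (pos : T -> R * R) (arc : {set T} -> R -> R * R) :
  plane_drawing E pos arc ->
  exists M : R, (forall v, (pos v).1 <= M) /\
    {in E, forall e : {set T}, {in `[0, 1], forall t, (arc e t).1 <= M}}.
Proof.
move=> dr.
have /choice[b hb] (e : {set T}) : exists b : R, e \in E ->
    {in `[0, 1], forall t, (arc e t).1 <= b}.
  have [eE|//] := boolP (e \in E); last by exists 0.
  have [|c _ hc] := @EVT_max R (fun t => (arc e t).1) 0 1 ler01.
    by move=> t; apply: (@continuous_comp _ _ _ (arc e : subspace _ -> _) fst t);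
      [exact: (arc_continuous dr eE)|exact: cvg_fst].
  by exists (arc e c).1.
exists (Num.max (\big[Num.max/0]_v (pos v).1) (\big[Num.max/0]_e b e)); split.
  by move=> v; rewrite le_max le_bigmax.
move=> e eE t t01; rewrite le_max; apply/orP; right.
by apply: le_trans (hb e eE t t01) _; exact: le_bigmax.
Qed.

Lemma planarS (R : realType) (T : finType) (E F : {set {set T}}) :
  E \subset F -> planar R F -> planar R E.
Proof.
move=> /subsetP sEF [pos [arc [p1 p2 p3 p4 p5 p6]]]; exists pos, arc.
split=> // [e /sEF|e /sEF|e /sEF|e /sEF|e f /sEF eF /sEF fF].
- exact: p2.
- exact: p3.
- exact: p4.
- exact: p5.
- exact: p6.
Qed.

(* The forest is drawn as parabolic arches over a book embedding, to the
   right of a drawing of the rest of the graph. *)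
Lemma planar_add_forest (R : realType) (T : finType) (E : {set {set T}})
    (U : {set T}) :
  simple_graph E ->
  {in E, forall e : {set T}, (e \subset U) || [disjoint e & U]} ->
  (forall S : {set T}, S \subset U -> S != set0 -> (#|induced E S| < #|S|)%N) ->
  planar R [set e in E | [disjoint e & U]] -> planar R E.
Proof.
move=> sE cl sp [pos0 [arc0 dr]]; have [M [posM arcM]] := drawing_bounded dr.
have [x [xinj xM xnc]] := book_embedding M sE sp.
(* [lh e] holds the abscissas of the ends of [e] in increasing order; [(0, 0)] is a dummy value. *)
have /choice[lh hlh] (e : {set T}) : exists p : R * R, e \in induced E U ->
    exists a b, [/\ a \in U, b \in U, e = [set a; b], p = (x a, x b) & x a < x b].
  have [|_] := boolP (e \in induced E U); last by exists (0, 0).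
  rewrite inE => /andP[eE eU].
  have /eqP/cards2P[a [b [ab eab]]] := card_edge sE eE.
  have [aU bU] : a \in U /\ b \in U.
    by split; apply: (subsetP eU); rewrite eab ?set21 ?set22.
  have [l|l|l] := ltgtP (x a) (x b).
  - by exists (x a, x b) => _; exists a, b.
  - by exists (x b, x a) => _; exists b, a; rewrite setUC.
  - by move: ab; rewrite (xinj _ _ aU bU l) eqxx.
pose pos v := if v \in U then (x v, 0) else pos0 v.
pose arc (e : {set T}) :=
  if e \subset U then parabola (lh e).1 (lh e).2 else arc0 e.
have old e : e \in E -> ~~ (e \subset U) ->
    e \in [set e in E | [disjoint e & U]].
  by move=> eE eU; have := cl e eE; rewrite (negbTE eU) inE eE.
have new e : e \in E -> e \subset U -> e \in induced E U.
  by move=> eE eU; rewrite inE eE.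
have oitv (t : R) : t \in `]0, 1[ -> t \in `[0, 1].
  by rewrite !in_itv /= => /andP[/ltW-> /ltW->].
(* The arches lie strictly to the right of [M], the old drawing weakly to its left. *)
have archM e (t : R) : e \in induced E U -> t \in `[0, 1] ->
    M < (parabola (lh e).1 (lh e).2 t).1.
  move=> /hlh[a [b [aU bU _ -> ab]]]; rewrite in_itv /= => /andP[t0 t1].
  have := xM a aU; have : 0 <= t * (x b - x a) by apply: mulr_ge0 => //; lra.
  lra.
have arch_gt0 e (t : R) : e \in induced E U -> t \in `]0, 1[ ->
    [/\ 0 < (parabola (lh e).1 (lh e).2 t).2,
      (lh e).1 < (parabola (lh e).1 (lh e).2 t).1 &
      (parabola (lh e).1 (lh e).2 t).1 < (lh e).2].
  move=> /hlh[a [b [aU bU _ -> ab]]]; rewrite in_itv /= => /andP[t0 t1].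
  have h1 : 0 < t * (x b - x a) by apply: mulr_gt0 => //; lra.
  have h2 : 0 < (1 - t) * (x b - x a) by apply: mulr_gt0; lra.
  by split; [apply: mulr_gt0; lra | lra | lra].
exists pos, arc; split.
- move=> v w; rewrite /pos; case: ifP => vU; case: ifP => wU.
  + by case; exact: xinj.
  + by move=> e; have := posM w; rewrite -e leNgt xM.
  + by move=> e; have := posM v; rewrite e leNgt xM.
  + exact: (pos_inj dr).
- move=> e eE; rewrite /arc; case: ifPn => eU.
    by apply: continuous_subspaceT; exact: parabola_continuous.
  exact: (arc_continuous dr (old e eE eU)).
- move=> e eE; rewrite /arc; case: ifPn => eU; last exact: (arc_inj dr (old e eE eU)).
  have [a [b [_ _ _ -> ab]]] := hlh e (new e eE eU).
  move=> s t _ _ [] /addrI /mulIf + _; apply.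
  by rewrite subr_eq0 gt_eqF.
- move=> e eE; rewrite /arc; case: ifPn => eU.
    have [a [b [aU bU eab -> ab]]] := hlh e (new e eE eU).
    have -> : parabola (x a, x b).1 (x a, x b).2 0 = pos a.
      by rewrite /parabola /pos aU /=; congr pair; ring.
    have -> : parabola (x a, x b).1 (x a, x b).2 1 = pos b.
      by rewrite /parabola /pos bU /=; congr pair; ring.
    apply/classical_sets.seteqP; split=> [p [] ->|p [v]] /=.
    + by exists a; rewrite //= eab set21.
    + by exists b; rewrite //= eab set22.
    + by rewrite eab !inE => /orP[]/eqP -> <-; [left|right].
  rewrite (arc_ends dr (old e eE eU)); apply: classical_sets.eq_imagel => v /= ve.
  have := old e eE eU; rewrite inE => /andP[_ eU'].
  by rewrite /pos (disjointFr eU' ve).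
- move=> e eE t v t01; rewrite /arc /pos; case: ifPn => eU; case: ifPn => vU.
  + apply/eqP => h; have [+ _ _] := arch_gt0 _ _ (new e eE eU) t01.
    by rewrite h ltxx.
  + apply/eqP => h; have := archM _ _ (new e eE eU) (oitv _ t01).
    by rewrite h ltNge posM.
  + apply/eqP => h; have := arcM _ (old e eE eU) _ (oitv _ t01).
    by rewrite h leNgt xM.
  + exact: (arc_avoids_vertices dr (old e eE eU) _ t01).
- move=> e f eE fE ef s t s01 t01; rewrite /arc; case: ifPn => eU; case: ifPn => fU.
  + have eI := new e eE eU; have fI := new f fE fU.
    apply/eqP; move: (arch_gt0 _ _ eI s01) (arch_gt0 _ _ fI t01).
    have [a [b [aU bU eab -> ab]]] := hlh e eI.
    have [c [d [cU dU fcd -> cd]]] := hlh f fI.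
    rewrite /parabola /=; set X := x a + _; set Y := x c + _.
    move=> [_ aX Xb] [_ cY Yd] [XY].
    rewrite -XY in cY Yd *.
    move: eE fE; rewrite eab fcd => eE fE.
    have n1 := xnc a b c aU bU cU d dU eE fE.
    have n2 := xnc c d a cU dU aU b bU fE eE.
    have nac : x a = x c -> x b = x d -> False.
      move=> /(xinj _ _ aU cU) ac /(xinj _ _ bU dU) bd.
      by move: ef; rewrite eab fcd ac bd eqxx.
    have below p q r z : p <= q -> z <= r -> p < q \/ z < r -> q < X -> X < z ->
        (X - q) * (z - X) < (X - p) * (r - X).
      by move=> pq zr pqzr qX Xz; nra.
    (* Both intervals contain the common abscissa [X]. As the edges do not cross in the book
       embedding, one interval contains the other, strictly since the edges differ, and its arch is
       higher at [X]. *)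
    move=> h; have [l|l|l] := ltgtP (x a) (x c).
    * have db : x d <= x b by rewrite leNgt; apply/negP => bd; apply: n1 => //; lra.
      by have := below _ _ _ _ (ltW l) db (or_introl l) cY Yd; lra.
    * have bd : x b <= x d by rewrite leNgt; apply/negP => db; apply: n2 => //; lra.
      by have := below _ _ _ _ (ltW l) bd (or_introl l) aX Xb; lra.
    * have [l'|l'|l'] := ltgtP (x b) (x d); last exact: nac l l'.
        have cle : x c <= x a by rewrite l.
        by have := below _ _ _ _ cle (ltW l') (or_intror l') aX Xb; lra.
      have ale : x a <= x c by rewrite l.
      by have := below _ _ _ _ ale (ltW l') (or_intror l') cY Yd; lra.
  + apply/eqP => h; have := archM _ _ (new e eE eU) (oitv _ s01).
    by rewrite h ltNge (arcM _ (old f fE fU)) // oitv.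
  + apply/eqP => h; have := archM _ _ (new f fE fU) (oitv _ t01).
    by rewrite -h ltNge (arcM _ (old e eE eU)) // oitv.
  + exact: (arc_disjoint dr (old e eE eU) (old f fE fU)).
Qed.
End Drawing.

(** * The switching operation and its double count *)

Section Switching.
Import mathcomp.boot.fintype mathcomp.boot.finset.

(** With a single function for all the ends, injectivity makes the edges a matching, and the choices
    are counted by a falling factorial. *)
Definition pair_edges (T I : finType) (f : {ffun I * bool -> T}) : {set {set T}} :=
  [set [set f (i, false); f (i, true)] | i : I].

Lemma pair_edges_simple (T I : finType) (f : {ffun I * bool -> T}) :
  injective f -> simple_graph (pair_edges f).
Proof.
move=> f_inj; apply/'forall_implyP => _ /imsetP[i _ ->].
by rewrite cards2 (inj_eq f_inj) xpair_eqE andbF.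
Qed.

Lemma pair_edges_meet (T I : finType) (f : {ffun I * bool -> T}) (i j : I) :
  injective f ->
  ~~ [disjoint [set f (i, false); f (i, true)] & [set f (j, false); f (j, true)]] ->
  i = j.
Proof.
by move=> f_inj /pred0Pn[v /= /andP[/set2P[]-> /set2P[] /f_inj []]].
Qed.

Lemma pair_edges_trivIset (T I : finType) (f : {ffun I * bool -> T}) :
  injective f -> trivIset (pair_edges f).
Proof.
move=> f_inj; apply/trivIsetP => _ _ /imsetP[i _ ->] /imsetP[j _ ->] ij.
by apply: contraNT ij => /(pair_edges_meet f_inj) ->.
Qed.

Lemma card_pair_edges (T I : finType) (f : {ffun I * bool -> T}) :
  injective f -> #|pair_edges f| = #|I|.
Proof.
move=> f_inj; rewrite card_imset // => i j e; apply: (pair_edges_meet f_inj).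
rewrite -e -setI_eq0 setIid.
by apply/set0Pn; exists (f (i, false)); rewrite set21.
Qed.

Lemma cover_pair_edges (T I : finType) (f : {ffun I * bool -> T}) (S : {set T}) :
  f \in ffun_on S -> cover (pair_edges f) \subset S.
Proof.
move=> /ffun_onP fS; apply/bigcupsP => _ /imsetP[i _ ->].
by rewrite subUset !sub1set !fS.
Qed.

Definition switch (T I : finType) (E : {set {set T}}) (c : seq T)
    (f : {ffun I * bool -> T}) : {set {set T}} :=
  (E :\: cycle_edges c) :|: pair_edges f.

(** [S] represents the tree components of the graph without the edges of [c]. Pairs from [S] keep
    these trees a forest, which creates no cycle and can be drawn apart from the rest. *)
Lemma switchP (R : realType) (T I : finType) (E : {set {set T}}) (c : seq T) :
  simple_graph E -> planar R E -> graph_cycle E c -> #|I| = size c ->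
  exists S : {set T}, #|T| <= #|S| + #|E| /\
    forall f : {ffun I * bool -> T}, injective f -> f \in ffun_on S ->
    [/\ simple_graph (switch E c f) /\ planar R (switch E c f),
        #|switch E c f| = #|E|,
        [disjoint E :\: cycle_edges c & pair_edges f],
        forall c', graph_cycle (switch E c f) c' -> graph_cycle E c' &
        ~~ graph_cycle (switch E c f) c].
Proof.
move=> sE pE hc cI; set E0 := E :\: cycle_edges c.
have sE0E : E0 \subset E := subsetDl _ _.
have sE0 := simple_graphS sE0E sE.
have indT : induced E0 setT = E0 by apply/setP => e; rewrite inE subsetT andbT.
have [U [S [sSU _ cl cT sp]]] := tree_representatives [set: T] sE0.
rewrite indT cardsT in cl cT.
exists S; split; first by rewrite (leq_trans cT) // leq_add2l subset_leq_card.
move=> f f_inj fS; set M := pair_edges f.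
have sM : simple_graph M := pair_edges_simple f_inj.
have cM : cover M \subset S := cover_pair_edges fS.
have sp' := matching_sparse sp sM (pair_edges_trivIset f_inj) cM.
have MU e : e \in M -> e \subset U.
  by move=> eM; apply: subset_trans sSU; apply: subset_trans cM; exact: (bigcup_sup e).
have dis : [disjoint E0 & M].
  rewrite -setI_eq0; apply/set0Pn => -[e /setIP[eE0 eM]].
  have eS : e \subset S by apply: subset_trans cM; exact: (bigcup_sup e).
  have ce := card_edge sE0 eE0.
  have e0 : e != set0 by rewrite -card_gt0 ce.
  (* An old edge between two representatives would give [1 + 2 <= 2] in the sparsity bound. *)
  have := sp e (MU e eM) e0; rewrite (setIidPl eS) ce (_ : maxn 1 2 = 2) //.
  rewrite -[leqRHS]add0n leq_add2r leqn0 cards_eq0 => /eqP/setP/(_ e).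
  by rewrite inE eE0 subxx inE.
have cyc c' : graph_cycle (switch E c f) c' -> graph_cycle E0 c'.
  exact: (cycle_avoids_forest sM MU cl sp').
have [sc uc hcE] := graph_cycleP _ _ hc.
have sE' : simple_graph (switch E c f).
  by apply/'forall_implyP => e /setUP[/(card_edge sE0) -> | /(card_edge sM) ->].
split=> //.
- split=> //; apply: (@planar_add_forest _ _ _ U) => //.
    by move=> e /setUP[/cl// | /MU ->].
  (* All new edges lie in [U], so what is left outside [U] is a subgraph of [E]. *)
  apply: planarS pE; apply/subsetP => e /[!inE]/andP[/orP[/andP[]//|eM] eU].
  have [v ve] := edge_end sM eM.
  by have := disjointFr eU ve; rewrite (subsetP (MU e eM)).
- rewrite cardsU (disjoint_setI0 dis) cards0 subn0 cardsD (setIidPr hcE).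
  rewrite card_cycle_edges // card_pair_edges // cI subnK //.
  by rewrite -(card_cycle_edges uc sc) subset_leq_card.
- move=> c' /cyc /graph_cycleP[sc' uc' hc']; apply/graph_cycleP; split=> //.
  exact: subset_trans hc' sE0E.
- apply/negP => /cyc /graph_cycleP[_ _] /subsetP hcE0.
  have [v vc] : exists v, v \in c.
    by move: sc; case: (c) => // v s _; exists v; rewrite mem_head.
  have ve : [set v; next c v] \in cycle_edges c by exact: imset_f.
  by have := hcE0 _ ve; rewrite inE ve.
Qed.

Lemma leq_card_darts (T : finType) (E : {set {set T}}) :
  simple_graph E -> #|[set p : T * T | [set p.1; p.2] \in E]| <= 2 * #|E|.
Proof.
move=> sE; rewrite -sum1dep_card mulnC -sum_nat_const.
rewrite (partition_big (fun p : T * T => [set p.1; p.2]) (mem E)) //=.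
apply: leq_sum => e eE; have /eqP/cards2P[a [b [_ ->]]] := card_edge sE eE.
rewrite sum1dep_card; apply: (@leq_trans #|[set (a, b); (b, a)]|); last first.
  by rewrite cards2; case: (_ != _).
apply: subset_leq_card; apply/subsetP => -[u v]; rewrite !inE /= => /andP[uvE /eqP uv].
have : u \in [set a; b] by rewrite -uv set21.
have : v \in [set a; b] by rewrite -uv set22.
have uneqv : u != v by move: (card_edge sE uvE); rewrite cards2; case: eqVneq.
rewrite !inE !xpair_eqE => /orP[]/eqP vE /orP[]/eqP uE; rewrite uE vE !eqxx ?orbT //.
all: by move: uneqv; rewrite uE vE eqxx.
Qed.

(** Such an [f] amounts to the choice of an oriented edge of [E] for each index. *)
Lemma leq_card_pairings (T I : finType) (E : {set {set T}}) : simple_graph E ->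
  #|[set f : {ffun I * bool -> T} | pair_edges f \subset E]| <= (2 * #|E|) ^ #|I|.
Proof.
move=> sE; set D := [set p : T * T | [set p.1; p.2] \in E].
apply: (@leq_trans (#|D| ^ #|I|)); last first.
  by have [->//|I0] := posnP #|I|; rewrite leq_exp2r ?leq_card_darts.
rewrite -card_ffun_on; pose h (f : {ffun I * bool -> T}) :=
  [ffun i : I => (f (i, false), f (i, true))].
have h_inj : injective h.
  move=> f g /ffunP fg; apply/ffunP => -[i b].
  by have := fg i; rewrite !ffunE => -[e0 e1]; case: b.
rewrite -(card_imset _ h_inj); apply: subset_leq_card.
apply/subsetP => _ /imsetP[f + ->]; rewrite inE => /subsetP fE.
apply/ffun_onP => i; rewrite ffunE inE /=.
by apply: fE; apply/imsetP; exists i.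
Qed.

Lemma leq_ffact2 (a b k : nat) : a <= b -> a ^_ k <= b ^_ k.
Proof.
by elim: k a b => // k IHk [|a] [|b] // ab; rewrite !ffactnS leq_mul ?IHk.
Qed.

Definition cycles_of_length (T : finType) (E : {set {set T}}) (l : nat) :
  {set l.-tuple T} := [set c : l.-tuple T | graph_cycle E c].

(* Double counting of the triples formed by a graph in [G], an [l]-cycle in it
   and a choice of [l] disjoint pairs of representatives: given the new graph,
   the cycle and the pairs, one recovers the old graph. *)
Lemma switch_count (R : realType) (n m l : nat) (G H : {set {set {set 'I_n}}}) :
  G \subset planar_graphs R n m ->
  (forall E E' c, E \in G -> E' \in planar_graphs R n m ->
    (forall c', graph_cycle E' c' -> graph_cycle E c') ->
    size c = l -> graph_cycle E c -> ~~ graph_cycle E' c -> E' \in H) ->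
  H \subset planar_graphs R n m ->
  (\sum_(E in G) #|cycles_of_length E l|) * (n - m) ^_ (2 * l) <=
  #|H| * (n ^ l * (2 * m) ^ l).
Proof.
move=> sG GH sH.
have pP E : E \in planar_graphs R n m -> [/\ simple_graph E, #|E| = m & planar R E].
  by rewrite inE => /and3P[? /eqP ? /asboolP ?].
have pP' E : simple_graph E -> #|E| = m -> planar R E -> E \in planar_graphs R n m.
  by move=> sE cE pE; rewrite inE sE cE eqxx /=; apply/asboolP.
have sw (p : {set {set 'I_n}} * l.-tuple 'I_n) : exists S : {set 'I_n},
    p.1 \in G -> p.2 \in cycles_of_length p.1 l -> n - m <= #|S| /\
    forall f : {ffun 'I_l * bool -> 'I_n}, injective f -> f \in ffun_on S ->
    switch p.1 p.2 f \in H /\ [disjoint p.1 :\: cycle_edges p.2 & pair_edges f].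
  case: p => E c /=; have [EG|_] := boolP (E \in G); last by exists set0.
  have [|_] := boolP (c \in _); last by exists set0.
  rewrite inE => hc; have [sE cE pE] := pP E (subsetP sG E EG).
  have [|S [cS hS]] := @switchP R _ 'I_l E c sE pE hc.
    by rewrite card_ord size_tuple.
  exists S => _ _; split; first by rewrite leq_subLR addnC -cE -[leqLHS]card_ord.
  move=> f f_inj fS; have [[sE' pE'] cE' dis cyc ncyc] := hS f f_inj fS.
  split=> //; apply: (GH E _ c) => //; last by rewrite size_tuple.
  by apply: pP' => //; rewrite cE'.
have [S hS] := choice sw.
pose F p := [set f in ffun_on (S p) | injectiveb f] : {set {ffun 'I_l * bool -> 'I_n}}.
pose PF (E : {set {set 'I_n}}) :=
  [set f : {ffun 'I_l * bool -> 'I_n} | pair_edges f \subset E].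
(* [A] collects the triples before the switching, [B] those after it; in [B] the cycle is recorded
   as an arbitrary [l]-tuple and the pairs are edges of the new graph. *)
pose A := [set q : {set {set 'I_n}} * l.-tuple 'I_n * {ffun 'I_l * bool -> 'I_n} |
  [&& q.1.1 \in G, q.1.2 \in cycles_of_length q.1.1 l & q.2 \in F q.1]].
pose B := [set q : {set {set 'I_n}} * l.-tuple 'I_n * {ffun 'I_l * bool -> 'I_n} |
  (q.1.1 \in H) && (q.2 \in PF q.1.1)].
apply: (@leq_trans #|A|).
  have -> : #|A| = \sum_(E in G) \sum_(c in cycles_of_length E l) #|F (E, c)|.
    under [RHS]eq_bigr do under eq_bigr do rewrite -sum1_card.
    rewrite !pair_big_dep -sum1_card; apply: eq_bigl => -[[E c] f].
    by rewrite inE /= andbA.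
  rewrite big_distrl /=; apply: leq_sum => E EG.
  rewrite -sum_nat_const; apply: leq_sum => c cE.
  have [cS _] := hS (E, c) EG cE.
  rewrite card_inj_ffuns_on card_prod card_ord card_bool mulnC.
  by apply: leq_ffact2.
have AP E c f : (E, c, f) \in A -> [/\ graph_cycle E c, switch E c f \in H &
    [disjoint E :\: cycle_edges c & pair_edges f]].
  rewrite inE /= => /and3P[EG cE]; rewrite inE => /andP[fS /injectiveP f_inj].
  have [_ /(_ f f_inj fS) [? ?]] := hS (E, c) EG cE.
  by move: cE; rewrite inE.
apply: (@leq_trans #|B|).
  pose h (q : {set {set 'I_n}} * l.-tuple 'I_n * {ffun 'I_l * bool -> 'I_n}) :=
    (switch q.1.1 q.1.2 q.2, q.1.2, q.2).
  have h_inj : {in A &, injective h}.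
    (* By disjointness, removing the pairs deletes no old edge; then the cycle is put back. *)
    have rec E c f : (E, c, f) \in A ->
        E = (switch E c f :\: pair_edges f) :|: cycle_edges c.
      move=> /AP[cE _ dis].
      have [_ _ /setIidPr cE'] := graph_cycleP _ _ cE.
      rewrite setDUl setDv setU0 (setDidPl _) //.
      by rewrite -{1}(setID E (cycle_edges c)) cE' setUC.
    move=> [[E c] f] [[E1 c1] f1] /rec e /rec e1 [eE ec ef].
    move: e e1; rewrite eE ec ef => e e1; congr (_, _, _); exact: etrans e (esym e1).
  rewrite -(card_in_imset h_inj); apply: subset_leq_card.
  apply/subsetP => _ /imsetP[[[E c] f] + ->].
  by move=> /AP[_ EH _]; rewrite !inE /= EH subsetUr.
have -> : #|B| = \sum_(E in H) \sum_(c : l.-tuple 'I_n) #|PF E|.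
  under [RHS]eq_bigr do under eq_bigr do rewrite -sum1_card.
  rewrite !pair_big_dep -sum1_card; apply: eq_bigl => -[[E c] f].
  by rewrite inE /= andbT.
rewrite -sum_nat_const; apply: leq_sum => E EH.
have [sE cE _] := pP E (subsetP sH E EH).
rewrite sum_nat_const card_tuple card_ord leq_mul2l; apply/orP; right.
by rewrite (leq_trans (leq_card_pairings _ sE)) // cE card_ord.
Qed.
End Switching.

(** * Counting graphs by their number of short cycles *)

Section Counting.
Import mathcomp.boot.fintype mathcomp.boot.finset.

(** Each of the [j] factors on the right is at least [a - j]. *)
Lemma leq_exp_ffact (a j : nat) : (a - j) ^ j <= a ^_ j.
Proof.
elim: j a => [|j IHj] a; first by rewrite expn0 ffactn0.
case: a => [|a]; first by rewrite sub0n exp0n.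
rewrite ffactnS /= subSS expnS leq_mul ?IHj //.
exact: leq_trans (leq_subr _ _) (leqnSn _).
Qed.

(** Cycles are vertex sequences here, so one of length [l] is counted [2 * l] times, once for each
    start and direction. *)
Definition short_cycles (k : nat) (T : finType) (E : {set {set T}}) : nat :=
  \sum_(l < k.+1) #|cycles_of_length E l|.

Lemma short_cycles_lt (k : nat) (T : finType) (E E' : {set {set T}}) (c : seq T) :
  (forall c', graph_cycle E' c' -> graph_cycle E c') -> size c <= k ->
  graph_cycle E c -> ~~ graph_cycle E' c -> short_cycles k E' < short_cycles k E.
Proof.
move=> sub sc hc nc.
have subc l : cycles_of_length E' l \subset cycles_of_length E l.
  by apply/subsetP => t; rewrite !inE; exact: sub.
have ck : size c < k.+1 by [].
rewrite /short_cycles (bigD1 (Ordinal ck)) //= [ltnRHS](bigD1 (Ordinal ck)) //=.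
rewrite -addSn leq_add //; last by apply: leq_sum => l _; exact: subset_leq_card.
apply: proper_card; apply/properP; split=> //.
by exists (in_tuple c); rewrite inE.
Qed.

(** Each length is switched separately. Put [p = n - m - 2 * k]: since [n <= D * p] and [m <= n],
    each deleted edge costs a factor of at most [n * (2 * m) / p ^ 2 <= 2 * D ^ 2]. The bound serves
    single layers of graphs and, with [G = H], the mean. *)
Lemma sum_short_cycles (R : realType) (n m k D : nat) (G H : {set {set {set 'I_n}}}) :
  0 < n -> n <= D * (n - m - 2 * k) ->
  G \subset planar_graphs R n m -> H \subset planar_graphs R n m ->
  (forall E E', E \in G -> E' \in planar_graphs R n m ->
    short_cycles k E' < short_cycles k E -> E' \in H) ->
  \sum_(E in G) short_cycles k E <= (\sum_(l < k.+1) (2 * D ^ 2) ^ l) * #|H|.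
Proof.
move=> n0 nD sG sH GH; rewrite exchange_big big_distrl /=; apply: leq_sum => l _.
set p := n - m - 2 * k in nD.
have p0 : 0 < p by have := leq_trans n0 nD; rewrite muln_gt0 => /andP[].
have lk : l <= k by rewrite -ltnS.
have hsw : (\sum_(E in G) #|cycles_of_length E l|) * (n - m) ^_ (2 * l) <=
    #|H| * (n ^ l * (2 * m) ^ l).
  apply: switch_count sG _ sH => E E' c EG E'P sub sc hc nc; apply: (GH E) => //.
  by apply: short_cycles_lt sub _ hc nc; rewrite sc.
rewrite -(@leq_pmul2r (p ^ (2 * l))) ?expn_gt0 ?p0 //.
apply: leq_trans (leq_trans hsw _).
  rewrite leq_mul2l; apply/orP; right.
  apply: leq_trans (leq_exp_ffact _ _); have [->//|l0] := posnP l.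
  by rewrite leq_exp2r ?muln_gt0 // leq_sub2l // leq_mul2l lk orbT.
rewrite [X in _ <= X * _]mulnC -mulnA leq_mul2l; apply/orP; right.
rewrite expnM -!expnMn; have [->//|l0] := posnP l.
rewrite leq_exp2r //.
(* Subtraction is truncated, so [p > 0] forces [m < n]. *)
have mn : m <= n by move: p0; rewrite /p -subnDA subn_gt0; lia.
apply: (@leq_trans (n * (2 * n))); first by rewrite !leq_mul2l mn !orbT.
rewrite mulnCA -mulnA leq_mul2l /= -expnMn.
by rewrite -[n * n]/(n ^ 2) leq_sqr.
Qed.

(** Descending from at most [2 * C] short cycles to none costs a factor [C.+1] per level, and by
    Markov's inequality the starting level contains at least half of the graphs. *)
Lemma few_short_cycles (R : realType) (n m k D : nat) :
  let P := planar_graphs R n m in let C := \sum_(l < k.+1) (2 * D ^ 2) ^ l in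
  0 < n -> n <= D * (n - m - 2 * k) ->
  #|P| <= 2 * C.+1 ^ (2 * C) * #|[set E in P | short_cycles k E == 0]|.
Proof.
move=> P C n0 nD; pose L j := [set E in P | short_cycles k E <= j].
have LP j : L j \subset P by apply/subsetP => E; rewrite inE => /andP[].
have step j : #|L j.+1| <= C.+1 * #|L j|.
  pose G := [set E in P | short_cycles k E == j.+1].
  have GP : G \subset P by apply/subsetP => E; rewrite inE => /andP[].
  have -> : L j.+1 = L j :|: G.
    by apply/setP => E; rewrite !inE -andb_orr [_ <= j.+1]leq_eqVlt orbC.
  rewrite mulSn (leq_trans (leq_card_setU _ _)) // leq_add2l.
  (* Each graph of the layer [G] contributes at least one to the sum, and its switchings land in
     [L j]. *)
  apply: leq_trans (@sum_short_cycles R n m k D G (L j) n0 nD GP (LP j) _).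
    rewrite -sum1_card; apply: leq_sum => E; rewrite inE => /andP[_ /eqP->//].
  move=> E E'; rewrite inE => /andP[_ /eqP->] E'P; rewrite ltnS => E'j.
  by rewrite inE E'P.
have bound j : #|L j| <= C.+1 ^ j * #|L 0|.
  elim: j => [|j IHj]; first by rewrite mul1n.
  by rewrite (leq_trans (step j)) // expnS -mulnA leq_mul2l IHj orbT.
have -> : [set E in P | short_cycles k E == 0] = L 0.
  by apply/setP => E; rewrite !inE leqn0.
rewrite -mulnA (@leq_trans (2 * #|L (2 * C)|)) ?leq_mul2l ?bound //.
have cP : #|P| = #|L (2 * C)| + #|P :\: L (2 * C)|.
  by rewrite -(cardsID (L (2 * C)) P) (setIidPr (LP _)).
(* A graph outside [L (2 * C)] has at least [2 * C + 1] short cycles, while the total is at most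
   [C * #|P|]. *)
have markov : #|P :\: L (2 * C)| * (2 * C).+1 <= C * #|P|.
  apply: leq_trans (@sum_short_cycles R n m k D P P n0 nD (subxx _) (subxx _) _) => //.
  rewrite -sum_nat_const [leqRHS](bigID (mem (L (2 * C)))) /=.
  apply: leq_trans (leq_addl _ _).
  rewrite big_mkcond [leqRHS]big_mkcond; apply: leq_sum => E _.
  rewrite !inE; case: [&& simple_graph E, _ & _]; rewrite /= ?andbF ?andbT //.
  by case: (leqP (short_cycles k E) (2 * C)).
(* Substitution gives [#|P| * (C + 1) <= #|L (2 * C)| * (2 * C + 1)]. *)
have {}cP : #|P| * C.+1 <= (2 * #|L (2 * C)|) * C.+1.
  move: markov cP; move: #|P :\: L (2 * C)| => a; move: #|L (2 * C)| => b.
  by move: #|P| (C) => c d; clear; nia.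
by rewrite leq_pmul2r in cP.
Qed.
End Counting.

(** * Girth and upper limits *)

Section Girth.
Local Open Scope classical_set_scope.
Local Open Scope ring_scope.

Lemma girth_le_short_cycles (R : realType) (k : nat) (T : finType)
    (E : {set {set T}}) :
  (girth R E <= (k%:R)%:E)%E -> (0 < short_cycles k E)%N.
Proof.
move=> gk; rewrite lt0n; apply: contraTneq gk => /eqP.
rewrite sum_nat_eq0 => /forallP nocyc; rewrite -ltNge.
(* The integer bound [k + 1] on all cycle lengths passes to the infimum and keeps the inequality
   strict. *)
apply: (@lt_le_trans _ _ (k.+1%:R)%:E); first by rewrite lte_fin ltr_nat.
apply: le_ereal_inf_tmp => _ [c /= hc <-]; rewrite lee_fin ler_nat ltnNge.
apply/negP => ck; have ck' : (size c < k.+1)%N by [].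
have := nocyc (Ordinal ck'); rewrite /= cards_eq0 => /eqP/setP/(_ (in_tuple c)).
by rewrite !inE hc.
Qed.

Lemma limn_esup_le_near (R : realType) (u : nat -> \bar R) (l : \bar R) (N : nat) :
  (forall n, (N <= n)%N -> (u n <= l)%E) -> (limn_esup u <= l)%E.
Proof.
move=> ul; rewrite limn_esup_lim; apply: lime_le; first exact: is_cvg_esups.
near=> n; apply: ge_ereal_sup => _ [j /= nj <-]; apply: ul.
by apply: leq_trans nj; near: n; exact: nbhs_infty_ge.
Unshelve. all: by end_near. Qed.

End Girth.

(** * The bound on the probability *)

Local Open Scope classical_set_scope.
Local Open Scope ring_scope.

Theorem theorem10p1 (R : realType) (k : nat) (A : R) (m : nat -> nat)
    (hA : A < 1)
    (hm : forall n : nat, (0 < n)%N -> (m n)%:R <= A * n%:R) :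
  (limn_esup (fun n : nat =>
     (uniform_pr R (planar_graphs R n (m n))
        (fun E => (girth R E <= (k%:R)%:E)%E))%:E) < 1)%E.
Proof.
have d0 : 0 < 1 - A by rewrite subr_gt0.
(* The factor 2 gives [2 * n <= D * (n - m n)]; for large [n], half of this absorbs the loss
   [D * (2 * k)]. *)
have [D hD] : exists D : nat, 2 <= D%:R * (1 - A).
  exists (Num.bound (2 / (1 - A))).
  by rewrite -ler_pdivrMr // ltW // archi_boundP // divr_ge0 // ltW.
pose C := (\sum_(l < k.+1) (2 * D ^ 2) ^ l)%N.
pose K := (2 * C.+1 ^ (2 * C))%N.
have K0 : (0 < K)%N by rewrite muln_gt0 expn_gt0.
have K0R : 0 < K%:R :> R by rewrite ltr0n.
(* For large [n], a fraction of at least [1 / K] of the graphs has no short cycle. *)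
apply: (@le_lt_trans _ _ (1 - K%:R^-1)%:E); last first.
  by rewrite lte_fin gtrBl invr_gt0.
apply: (@limn_esup_le_near _ _ _ (D * (2 * k)).+1) => n hn; rewrite lee_fin.
have n0 : (0 < n)%N by exact: leq_ltn_trans hn.
set P := planar_graphs R n (m n).
have nD : (n <= D * (n - m n - 2 * k))%N.
  have : (2 * n + D * m n <= D * n)%N.
    rewrite -(ler_nat R) natrD !natrM.
    have n0R : 0 <= n%:R :> R by [].
    have h1 : D%:R * (m n)%:R <= D%:R * (A * n%:R) :> R by rewrite ler_wpM2l // hm.
    have h2 : 2 * n%:R <= D%:R * (1 - A) * n%:R by rewrite ler_wpM2r.
    by lra.
  by rewrite -subnDA mulnBr mulnDr; lia.
have few := @few_short_cycles R n (m n) k D n0 nD.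
rewrite -/P -/C -/K in few.
(* A graph of girth at most [k] has a short cycle, so the two sets are disjoint. *)
have hle : (#|[set E in P | (girth R E <= (k%:R)%:E)%E]%SET| +
            #|[set E in P | short_cycles k E == 0%N]%SET| <= #|P|)%N.
  rewrite -cardsUI (_ : (_ :&: _)%SET = finset.set0) ?finset.cards0 ?addn0.
    apply: subset_leq_card; apply/fintype.subsetP => E.
    by rewrite !inE => /orP[]/andP[].
  apply/finset.setP => E; rewrite !inE; apply/negP.
  move=> /andP[/andP[_ /girth_le_short_cycles]].
  by rewrite lt0n => /negbTE->; rewrite andbF.
rewrite /uniform_pr; have [P0|P0] := posnP #|P|.
  (* Without any graph the probability is 0 by convention. *)
  by rewrite P0 invr0 mulr0 subr_ge0 invf_le1 // ler1n.
rewrite ler_pdivrMr ?ltr0n // mulrBl mul1r lerBrDr.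
move: few hle; rewrite -!(ler_nat R) natrD natrM => few; apply: le_trans.
by rewrite lerD2l mulrC ler_pdivrMr // mulrC.
Qed.
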